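(* For a constant $C>0$ and each integer $n \ge C$, $n\ge 1$, let $G = G_n$ be the Erdős–Rényi random graph on the vertex set $\{1,2,\dots,n\}$ with edge probability $p = \frac{C}{n}$. For $M>0$, let $E(M)$ denote the event that there is a component of $G$ containing at least $n - n e^{-C/8}$ vertices and every other component of $G$ contains less than $M\log n$ vertices. There is a positive constant $C_0$ such that the following holds: if $C > C_0$, there is a positive constant $M = M(C)$ (independent of $n$) such that $$\mathbb{P}(E(M)) \ge 1 - e^{-\frac{C}{100}}$$ for all $n$ sufficiently large.
   Context: The Erdős–Rényi random graph on $\{1,\dots,n\}$ with edge probability $p$ is the random simple graph in which each of the $\binom{n}{2}$ possible edges $\{i,j\}$, $i\neq j$, is present (open) with probability $p$ and absent (closed) otherwise, independently of all other edges. A component (also called open component) of $G$ is a connected component of the graph formed by the open edges (an isolated vertex is a component with one vertex). $\log$ is the natural logarithm. All constants are independent of $n$; the threshold in ''$n$ sufficiently large'' may depend on $C$. *)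

(* Defs.v *)
From HB Require Import structures.
From mathcomp Require Import all_boot all_order all_algebra.
From mathcomp Require Import reals sequences exp.

Set Implicit Arguments.
Unset Strict Implicit.
Unset Printing Implicit Defensive.
Import Order.TTheory GRing.Theory Num.Theory.
Local Open Scope ring_scope.

(* The vertex set {1, ..., n} is relabelled as 'I_n = {0, ..., n - 1}. *)
Definition edge (n : nat) := {e : {set 'I_n} | #|e| == 2%N}.

(* A simple graph is its set of open edges; every set of edges is a graph. *)
Definition graph (n : nat) := {set edge n}.

Definition adj n (G : graph n) : rel 'I_n :=
  fun x y => [exists e in G, val e == [set x; y]].

Definition component n (G : graph n) (x : 'I_n) : {set 'I_n} :=
  [set y | connect (adj G) x y].

Definition components n (G : graph n) : {set {set 'I_n}} :=
  [set component G x | x : 'I_n].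

(* The product law on graphs: each edge is open with probability p,
   independently of the others. See er_prob_indep. *)
Definition er_mass (R : realType) n (p : R) (G : graph n) : R :=
  \prod_(e : edge n) (if e \in G then p else 1 - p).

Definition er_prob (R : realType) n (p : R) (A : {set graph n}) : R :=
  \sum_(G in A) er_mass p G.

Definition event_E (R : realType) (C M : R) (n : nat) : {set graph n} :=
  [set G : graph n |
    [exists K in components G,
      (n%:R - n%:R * expR (- (C / 8)) <= #|K|%:R :> R) &&
      [forall K' in components G,
        (K' != K) ==> (#|K'|%:R < M * ln n%:R :> R)]]].

Lemma card_edge n : #|{: edge n}| = 'C(n, 2).
Proof.
rewrite card_sig -[n in RHS]card_ord -card_draws.
by apply: eq_card => e; rewrite !inE.
Qed.

Lemma er_prob_indep (R : realType) n (p : R) (S T : {set edge n}) :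
  [disjoint S & T] ->
  er_prob p [set G : graph n | (S \subset G) && [disjoint T & G]] =
  p ^+ #|S| * (1 - p) ^+ #|T|.
Proof.
move=> dST.
pose F e := if e \in T then 0 else p.
pose H e := if e \in S then 0 else 1 - p.
transitivity (\sum_(G : {set edge n})
    \prod_(e : edge n) (if e \in G then F e else H e)).
  rewrite /er_prob big_mkcond /=; apply: eq_bigr => G _.
  rewrite inE; case: ifPn => [/andP[sSG dTG]|].
    apply: eq_bigr => e _; rewrite /F /H; case: ifPn => eG.
      by case: ifPn => // eT; rewrite (disjointFr dTG eT) in eG.
    by case: ifPn => // eS; rewrite (subsetP sSG _ eS) in eG.
  rewrite negb_and => /orP[/subsetPn[e eS eG]|].
    by rewrite (bigD1 e) //= (negPf eG) /H eS mul0r.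
  rewrite -setI_eq0 => /set0Pn[e]; rewrite inE => /andP[eT eG].
  by rewrite (bigD1 e) //= eG /F eT mul0r.
rewrite -bigA_distr -!prodr_const.
rewrite [\prod_(i in S) _]big_mkcond [\prod_(i in T) _]big_mkcond -big_split /=.
apply: eq_bigr => e _; rewrite /F /H; case: ifPn => eT.
  by rewrite (disjointFl dST eT) add0r mul1r.
by case: ifPn => _; rewrite mulr1 ?addr0 // addrC subrK.
Qed.

(* Main.v *)
Require Import Defs.
From HB Require Import structures.
From mathcomp Require Import all_boot all_order all_algebra.
From mathcomp Require Import reals sequences exp.
From mathcomp Require Import ring lra zify.
Set Implicit Arguments.
Unset Strict Implicit.
Unset Printing Implicit Defensive.
Import Order.TTheory GRing.Theory Num.Theory.
Local Open Scope ring_scope.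

(* Two first-moment bounds. A set of [k <= n / 2] vertices has no open edge to
   its complement with probability at most [exp (- C k / 2)]; since
   ['C(n, k) <= (e n / k) ^ k], with high probability no such set has
   [k >= n exp (- C / 8)]. If moreover the set is a component, then pointing each
   vertex to a neighbour closer to a fixed root gives [k - 1] distinct open edges;
   there are only [k ^ (k - 1)] parent maps, so the expected number of components
   of size [k] is at most [n (e C exp (- C / 2)) ^ k <= n exp (- k)], which is
   negligible as soon as [k >= 4 ln n]. Outside these two events there is a unique
   component with more than [n / 2] vertices, and it has the required size. *)

(** * Union bounds under the product law *)

Section UnionBound.
Variables (R : realType) (n : nat) (p : R).
Hypotheses (p_ge0 : 0 <= p) (p_le1 : p <= 1).

Lemma er_mass_ge0 (G : graph n) : 0 <= er_mass p G.
Proof. by apply: prodr_ge0 => e _; case: ifP; rewrite ?subr_ge0. Qed.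

Lemma er_prob_subset (A B : {set graph n}) :
  A \subset B -> er_prob p A <= er_prob p B.
Proof.
move=> sAB; rewrite /er_prob [leRHS](big_setID A) /= (setIidPr sAB).
by rewrite lerDl sumr_ge0 // => G _; apply: er_mass_ge0.
Qed.

Lemma er_prob_setT : er_prob p [set: graph n] = 1.
Proof.
have := @er_prob_indep R n p set0 set0.
rewrite !cards0 !expr0 mulr1 => <-; last by rewrite -setI_eq0 setI0.
congr er_prob; apply/setP => G.
by rewrite !inE sub0set -setI_eq0 set0I eqxx.
Qed.

Lemma er_probC (A : {set graph n}) : er_prob p A = 1 - er_prob p (~: A).
Proof.
apply/eqP; rewrite eq_sym subr_eq -er_prob_setT /er_prob.
rewrite (bigID (mem A)) /=; apply/eqP; congr (_ + _).
  by apply: eq_bigl => G; rewrite inE.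
by apply: eq_bigl => G; rewrite !inE.
Qed.

Lemma er_prob_le_sum (I : finType) (P : pred I) (A : {set graph n})
    (B : I -> {set graph n}) :
  (forall G, G \in A -> exists2 i, P i & G \in B i) ->
  er_prob p A <= \sum_(i | P i) er_prob p (B i).
Proof.
move=> AB; rewrite /er_prob.
under [leRHS]eq_bigr do rewrite big_mkcond /=.
rewrite exchange_big big_mkcond /=; apply: ler_sum => G _.
have ge0 i : 0 <= (if G \in B i then er_mass p G else 0).
  by case: ifP => // _; apply: er_mass_ge0.
case: ifP => [/AB[i Pi GBi]|_]; last exact: sumr_ge0.
by rewrite (bigD1 i) //= GBi lerDl sumr_ge0.
Qed.

Lemma er_prob_setU (A B : {set graph n}) :
  er_prob p (A :|: B) <= er_prob p A + er_prob p B.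
Proof.
rewrite (le_trans (@er_prob_le_sum bool predT _ (fun b => if b then A else B) _)) //.
  by move=> G; rewrite inE => /orP[?|?]; [exists true|exists false].
by rewrite big_bool.
Qed.

(** Powers of [p] and [1 - p] decrease with the exponent, so lower bounds on the numbers of forced
    open and closed edges suffice. *)
Lemma er_prob_sub_indep (A : {set graph n}) (S T : {set edge n}) s t :
  [disjoint S & T] -> (s <= #|S|)%N -> (t <= #|T|)%N ->
  (forall G, G \in A -> (S \subset G) && [disjoint T & G]) ->
  er_prob p A <= p ^+ s * (1 - p) ^+ t.
Proof.
move=> dST sS tT AST.
apply: (@le_trans _ _ (p ^+ #|S| * (1 - p) ^+ #|T|)).
  rewrite -er_prob_indep //; apply: er_prob_subset.
  by apply/subsetP => G /AST; rewrite inE.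
apply: ler_pM; rewrite ?exprn_ge0 ?subr_ge0 //.
  by apply: ler_wiXn2l.
by apply: ler_wiXn2l; rewrite ?subr_ge0 // lerBlDr lerDl.
Qed.

(** Group the sets by size: there are [n.+1] sizes, and the ['C(n, k)] sets of size [k] contribute
    at most [b] together. *)
Lemma sum_set_card_le (P : pred {set 'I_n}) (g : {set 'I_n} -> R) (b : R) :
  0 <= b -> (forall S, P S -> 'C(n, #|S|)%:R * g S <= b) ->
  \sum_(S | P S) g S <= n.+1%:R * b.
Proof.
move=> b0 gb.
have C0 (k : nat) : (k <= n)%N -> 0 < 'C(n, k)%:R :> R by rewrite ltr0n bin_gt0.
have cardn (S : {set 'I_n}) : (#|S| <= n)%N by rewrite -[n in leqRHS]card_ord max_card.
apply: (@le_trans _ _ (\sum_(S : {set 'I_n}) b / 'C(n, #|S|)%:R)).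
  rewrite big_mkcond; apply: ler_sum => S _; case: ifP => [PS|_].
    by rewrite ler_pdivlMr ?C0 // mulrC gb.
  by rewrite divr_ge0 // ltW // C0.
have cardlt (S : {set 'I_n}) : (#|S| < n.+1)%N by rewrite ltnS.
rewrite (partition_big (fun S : {set 'I_n} => Ordinal (cardlt S)) predT) //=.
rewrite (eq_bigr (fun=> b)) => [|k _].
  by rewrite sumr_const card_ord mulr_natl.
rewrite (eq_bigr (fun=> b / 'C(n, k)%:R)) => [|S /eqP <- //].
rewrite sumr_const (_ : #|_| = 'C(n, k)).
  by rewrite -[LHS]mulr_natr divfK // gt_eqF // C0 // -ltnS.
have := card_draws 'I_n k; rewrite card_ord => <-.
by apply: eq_card => S; rewrite inE.
Qed.

End UnionBound.

(** * Edge cuts, components and parent maps *)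

Section Cuts.
Variable n : nat.
Implicit Types (S : {set 'I_n}) (G : graph n).

Definition edge_cut S : {set edge n} :=
  [set e | [exists x in S, exists y in ~: S, val e == [set x; y]]].

Lemma adj_edge G x y : adj G x y -> exists2 e, e \in G & val e = [set x; y].
Proof. by case/existsP=> e /andP[eG /eqP]; exists e. Qed.

Lemma adj_sym G : symmetric (adj G).
Proof. by move=> x y; rewrite /adj setUC. Qed.

Lemma set2_eq (T : finType) (x y u v : T) :
  [set x; y] = [set u; v] -> (x = u /\ y = v) \/ (x = v /\ y = u).
Proof.
move=> E.
have /set2P xE : x \in [set u; v] by rewrite -E set21.
have /set2P yE : y \in [set u; v] by rewrite -E set22.
have /set2P uE : u \in [set x; y] by rewrite E set21.
have /set2P vE : v \in [set x; y] by rewrite E set22.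
by case: xE yE uE vE => -> [->|->] [] ? [] ?; subst; auto.
Qed.

Lemma disjoint_cutP G S :
  reflect (forall x y, x \in S -> adj G x y -> y \in S) [disjoint edge_cut S & G].
Proof.
apply: (iffP idP) => [dS x y xS /adj_edge[e eG eE]|clS].
  apply: contraTT eG => yS; rewrite (disjointFr dS) // inE.
  by apply/exists_inP; exists x => //; apply/exists_inP; exists y; rewrite ?inE ?eE.
rewrite disjoint_subset; apply/subsetP => e; rewrite !inE.
case/exists_inP=> x xS /exists_inP[y]; rewrite inE => yS eE.
apply: contra yS => eG; apply: (clS x) => //.
by apply/exists_inP; exists e.
Qed.

(** Pairs in [S] times its complement give distinct edges: membership in [S] tells the two endpoints
    apart. *)
Lemma card_cut S : (#|S| * (n - #|S|) <= #|edge_cut S|)%N.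
Proof.
rewrite -(card_imset _ val_inj).
have -> : (n - #|S| = #|~: S|)%N by rewrite [RHS]cardsCs setCK card_ord.
rewrite -cardsX -(@card_in_imset _ _ (fun z => [set z.1; z.2])).
  apply/subset_leq_card/subsetP => _ /imsetP[[x y] /= + ->].
  rewrite !inE /= => /andP[xS yS].
  have c2 : #|[set x; y]| == 2%N.
    by rewrite cards2; case: (eqVneq x y) yS => // <-; rewrite xS.
  apply/imsetP; exists (exist _ [set x; y] c2) => //.
  rewrite inE; apply/exists_inP; exists x => //.
  by apply/exists_inP; exists y; rewrite ?inE.
move=> [x y] [u v] /=; rewrite !inE /= => /andP[xS yS] /andP[uS vS].
by case/set2_eq=> [[-> ->]//|[xv _]]; rewrite -xv xS in vS.
Qed.

Lemma component_refl G x : x \in component G x.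
Proof. by rewrite inE connect0. Qed.

Lemma component_closed G x : [disjoint edge_cut (component G x) & G].
Proof.
apply/disjoint_cutP => y z; rewrite !inE => xy yz.
by rewrite (connect_trans xy) // connect1.
Qed.

Lemma component_eq G x y : y \in component G x -> component G y = component G x.
Proof.
rewrite inE => xy; apply/setP => z; rewrite !inE.
by rewrite (same_connect _ xy) //; apply: sym_connect_sym; apply: adj_sym.
Qed.

Lemma components_disjoint G K L :
  K \in components G -> L \in components G -> K != L -> [disjoint K & L].
Proof.
case/imsetP=> x _ -> /imsetP[y _ ->]; apply: contraR.
rewrite -setI_eq0 => /set0Pn[z]; rewrite inE => /andP[zx zy].
by rewrite -(component_eq zx) -(component_eq zy).
Qed.

(** For arbitrary [f], a fixed point yields no edge and two vertices may share one, so the size of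
    this set has to be controlled separately. *)
Definition parent_edges S (r : 'I_n) (f : 'I_n -> 'I_n) : {set edge n} :=
  [set e | [exists v in S :\ r, val e == [set v; f v]]].

(** A parent edge has both ends in [S], a cut edge only one. This makes the open and closed
    requirements independent. *)
Lemma disjoint_parent_cut S r (f : 'I_n -> 'I_n) :
  {in S :\ r, forall v, f v \in S} -> [disjoint parent_edges S r f & edge_cut S].
Proof.
move=> fS; rewrite disjoint_subset; apply/subsetP => e; rewrite !inE.
case/exists_inP=> v vS /eqP eE; apply/negP => /exists_inP[x xS].
case/exists_inP=> y; rewrite inE => yS; rewrite eE => /eqP/set2_eq.
have := vS; rewrite inE => /andP[_ vS'].
case=> -[] ? ?; subst; first by rewrite fS in yS.
by rewrite vS' in yS.
Qed.

(** Take for [d] the length of a shortest path from [r], and for [u] the vertex before [v] on such a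
    path. *)
Lemma connect_distance G r : exists d : 'I_n -> nat,
  forall v, v \in component G r -> v != r ->
  exists u, [/\ u \in component G r, adj G u v & (d u < d v)%N].
Proof.
pose reach m v := [exists p : m.-tuple 'I_n, path (adj G) r p && (last r p == v)].
have reachP p : path (adj G) r p -> reach (size p) (last r p).
  by move=> pp; apply/existsP; exists (in_tuple p); rewrite pp eqxx.
(* The implication makes the minimum exist for unreachable vertices too; they get distance 0. *)
have ex v : exists m, connect (adj G) r v ==> reach m v.
  case: (boolP (connect (adj G) r v)) => [/connectP[p pp ->]|_]; last by exists 0%N.
  by exists (size p); rewrite implyTb reachP.
exists (fun v => ex_minn (ex v)) => v; rewrite inE => rv vr.
case: (ex_minnP (ex v)) => m; rewrite rv implyTb => /existsP[p /andP[pp /eqP pv]] _.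
have sp := size_tuple p.
case/lastP: {p}(tval p) pp pv sp => [_ E|q w]; first by rewrite -E eqxx in vr.
rewrite rcons_path last_rcons size_rcons => /andP[qq qw] wv <-; subst w.
have ru : connect (adj G) r (last r q) by apply/connectP; exists q.
exists (last r q); split; rewrite ?inE //.
by case: ex_minnP => k _; apply; rewrite ru reachP.
Qed.

(** Send each vertex other than [r] to a neighbour closer to [r]. Two vertices sharing a parent edge
    would be parents of each other, each strictly closer to [r] than the other. *)
Lemma component_parent G S r : S \in components G -> r \in S ->
  exists f : {ffun 'I_n -> 'I_n}, [/\ f \in pffun_on r (mem (S :\ r)) (mem S),
    (#|S|.-1 <= #|parent_edges S r f|)%N & parent_edges S r f \subset G].
Proof.
case/imsetP=> r0 _ -> /component_eq <-; set K := component G r.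
have [d dP] := connect_distance G r.
pose Q v u := [&& u \in K, adj G u v & (d u < d v)%N].
(* The outer [r] is the value [pffun_on] demands off [K :\ r]; the inner default is never reached,
   by [fP]. *)
pose f := [ffun v => if v \in K :\ r then odflt r [pick u | Q v u] else r].
have fP v : v \in K :\ r -> Q v (f v).
  move=> vK; rewrite ffunE vK; case: pickP => //= noQ.
  move: vK; rewrite in_setD1 => /andP[vr /dP/(_ vr)[u [uK uv du]]].
  by have := noQ u; rewrite /Q uK uv du.
exists f; split.
- apply/pffun_onP; split.
    apply/subsetP => v; rewrite inE /= ffunE.
    by case: ifP => // _; rewrite eqxx.
  move=> _ /imageP[v /= vK ->].
  by have /and3P[] := fP v vK.
- have -> : (#|K|.-1 = #|K :\ r|)%N by rewrite [#|K|](cardsD1 r) component_refl.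
  rewrite -(card_imset _ val_inj) -(@card_in_imset _ _ (fun v => [set v; f v])).
    apply/subset_leq_card/subsetP => _ /imsetP[v vK ->].
    have /and3P[_ /adj_edge[e eG eE] _] := fP v vK.
    have {}eE : val e = [set v; f v] by rewrite eE setUC.
    apply/imsetP; exists e; last by rewrite eE.
    by rewrite inE; apply/exists_inP; exists v => //; apply/eqP.
  move=> v w vK wK /set2_eq[[]//|[vE wE]].
  have /and3P[_ _ dv] := fP v vK; have /and3P[_ _ dw] := fP w wK.
  by rewrite -vE -wE in dw; move: (ltn_trans dv dw); rewrite ltnn.
- apply/subsetP => e; rewrite inE => /exists_inP[v vK /eqP eE].
  have /and3P[_ /adj_edge[e' eG eE'] _] := fP v vK.
  by rewrite (_ : e = e') //; apply: val_inj; rewrite eE eE' setUC.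
Qed.

End Cuts.

(* A closed set of at most [n / 2] vertices of maximal size becomes larger than
   [n / 2] when one more component is added, which forces that component to be
   the giant one. *)
Lemma giant_component (R : realType) n (G : graph n) (a L : R) :
  (0 < n)%N -> 0 < a -> a < 4^-1 ->
  (forall S : {set 'I_n}, [disjoint edge_cut S & G] -> (#|S|.*2 <= n)%N ->
     #|S|%:R < n%:R * a) ->
  (forall K, K \in components G -> (#|K|.*2 <= n)%N -> #|K|%:R < L) ->
  exists2 K, K \in components G & n%:R - n%:R * a <= #|K|%:R /\
    forall K', K' \in components G -> K' != K -> #|K'|%:R < L.
Proof.
move=> n0 a0 a4 small_closed small_comp.
have nR0 : 0 < n%:R :> R by rewrite ltr0n.
pose P (S : {set 'I_n}) := [disjoint edge_cut S & G] && (#|S|.*2 <= n)%N.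
have P0 : P set0.
  by rewrite /P cards0 double0 leq0n andbT; apply/disjoint_cutP => x y; rewrite inE.
case: (arg_maxnP (fun S : {set 'I_n} => #|S|) P0) => S /andP[clS Sn] maxS.
have Sa := small_closed S clS Sn.
have [x xS] : exists x, x \notin S.
  have : (#|S| < n)%N by lia.
  move=> ltSn; have /set0Pn[x] : ~: S != set0.
    by rewrite -card_gt0 cardsCs setCK card_ord subn_gt0.
  by rewrite inE; exists x.
set K := component G x; have KG : K \in components G by apply: imset_f.
have clK : [disjoint edge_cut K & G] by apply: component_closed.
have KbigN : (n < #|K|.*2)%N.
  rewrite ltnNge; apply/negP => Kn.
  have Ka := small_closed K clK Kn.
  have clSK : [disjoint edge_cut (S :|: K) & G].
    apply/disjoint_cutP => y z; rewrite !in_setU => /orP[yS|yK] yz.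
      by rewrite (disjoint_cutP _ _ clS y).
    by rewrite (disjoint_cutP _ _ clK y) ?orbT.
  have ltS : (#|S| < #|S :|: K|)%N.
    apply: proper_card; rewrite properE subsetUl /=.
    apply/subsetPn; exists x => //.
    by rewrite in_setU component_refl orbT.
  have SKn : (n < #|S :|: K|.*2)%N.
    rewrite ltnNge; apply/negP => SKn.
    by move: (leq_ltn_trans (maxS _ (introT andP (conj clSK SKn))) ltS); rewrite ltnn.
  (* Yet [S] and [K] each have fewer than [n * a < n / 4] vertices, a contradiction. *)
  have : n%:R < 2 * (#|S|%:R + #|K|%:R) :> R.
    rewrite -natrD -natrM ltr_nat; apply: (leq_trans SKn).
    by rewrite mul2n leq_double cardsU leq_subr.
  have : n%:R * a < n%:R * 4^-1 by rewrite ltr_pM2l.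
  lra.
exists K => //; split.
  have cC : #|~: K| = (n - #|K|)%N by rewrite cardsCs setCK card_ord.
  have Kn : (#|K| <= n)%N by rewrite -[n in leqRHS]card_ord max_card.
  (* By symmetry of [adj] the complement of [K] is closed as well, and it has fewer than [n / 2]
     vertices. *)
  have : #|~: K|%:R < n%:R * a.
    apply: small_closed; last by rewrite cC; lia.
    apply/disjoint_cutP => y z; rewrite !in_setC => yK yz; apply: contra yK => zK.
    by apply: (disjoint_cutP _ _ clK z) => //; rewrite adj_sym.
  by rewrite cC natrB //; lra.
move=> K' K'G K'K; apply: small_comp => //.
have := components_disjoint K'G KG K'K.
rewrite -leq_card_setU => /eqP cU.
have : (#|K' :|: K| <= n)%N by rewrite -[n in leqRHS]card_ord max_card.
by rewrite cU; lia.
Qed.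

(** * Probability that a given set is closed, or is a component *)

Section SetProbability.
Variables (R : realType) (n : nat) (p : R).
Hypotheses (p_ge0 : 0 <= p) (p_le1 : p <= 1).
Implicit Types S : {set 'I_n}.

Lemma er_prob_closed S :
  er_prob p [set G : graph n | [disjoint edge_cut S & G]] <= (1 - p) ^+ (#|S| * (n - #|S|)).
Proof.
rewrite -[leRHS]mul1r -[X in X * _](expr0 p).
apply: (er_prob_sub_indep p_ge0 p_le1 (S := set0) (T := edge_cut S)) => //.
- by rewrite -setI_eq0 set0I.
- exact: card_cut.
- by move=> G; rewrite inE sub0set.
Qed.

(** Union bound over the parent maps on [S] rooted at some [r]: each forces [#|S|.-1] open edges
    inside [S] and a closed cut. *)
Lemma er_prob_component S : (0 < #|S|)%N ->
  er_prob p [set G : graph n | S \in components G] <=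
  (#|S|%:R * p) ^+ #|S|.-1 * (1 - p) ^+ (#|S| * (n - #|S|)).
Proof.
case/card_gt0P=> r rS.
pose V (f : {ffun 'I_n -> 'I_n}) :=
  (f \in pffun_on r (mem (S :\ r)) (mem S)) && (#|S|.-1 <= #|parent_edges S r f|)%N.
pose B (f : {ffun 'I_n -> 'I_n}) :=
  [set G : graph n | (parent_edges S r f \subset G) && [disjoint edge_cut S & G]].
set b := (1 - p) ^+ _.
have b0 : 0 <= b by rewrite exprn_ge0 // subr_ge0.
apply: le_trans (er_prob_le_sum p_ge0 p_le1 (P := V) (B := B) _) _.
  move=> G; rewrite inE => SG.
  have [f [fon fc fG]] := component_parent SG rS.
  exists f; first by rewrite /V fon.
  rewrite inE fG; case/imsetP: SG => x _ ->; exact: component_closed.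
(* Maps with too few parent edges are added back with nonnegative terms, so that the sum runs over
   all [#|S| ^ #|S|.-1] maps. *)
apply: (@le_trans _ _ (\sum_(f in pffun_on r (mem (S :\ r)) (mem S)) p ^+ #|S|.-1 * b)).
  rewrite [leLHS]big_mkcond [leRHS]big_mkcond; apply: ler_sum => f _.
  rewrite /V; case: ifP => /= [/andP[fon fc]|_]; last first.
    by case: ifP => // _; rewrite mulr_ge0 // exprn_ge0.
  rewrite fon.
  apply: (er_prob_sub_indep p_ge0 p_le1 (S := parent_edges S r f) (T := edge_cut S)) => //.
  - apply: disjoint_parent_cut => v vS.
    by have /pffun_onP[_] := fon; apply; apply: image_f.
  - exact: card_cut.
  - by move=> G; rewrite inE.
rewrite sumr_const card_pffun_on.
have -> : #|mem (S :\ r)| = #|S|.-1 by rewrite [in RHS](cardsD1 r) rS.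
by rewrite -[leLHS]mulr_natl natrX exprMn mulrA.
Qed.

End SetProbability.

(** * Numerical estimates *)

Section Estimates.
Variable R : realType.

(** [k ^ k / k!] is one term of the series of [expR k], and the falling factorial of [n] is at most
    [n ^ k]. *)
Lemma bin_expn_le (n k : nat) :
  'C(n, k)%:R * k%:R ^+ k <= n%:R ^+ k * expR k%:R :> R.
Proof.
have kk : k%:R ^+ k <= k`!%:R * expR k%:R :> R.
  case: k => [|k]; first by rewrite expr0 fact0 expR0 mulr1.
  rewrite mulrC -ler_pdivrMr ?ltr0n ?fact_gt0 //.
  by apply: le_trans (expR_ge1Dxn k (ler0n _ _)); rewrite lerDr.
apply: le_trans (ler_wpM2l (ler0n _ _) kk) _.
rewrite mulrA ler_wpM2r ?expR_ge0 // -natrM -natrX ler_nat bin_ffact.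
rewrite ffact_prod -[in leqRHS](card_ord k) -prod_nat_const.
by apply: leq_prod => i _; rewrite leq_subr.
Qed.

(** Use [1 - x <= expR (- x)] and [n - k >= n / 2]. *)
Lemma cut_factor_le (C : R) (n k : nat) : 0 <= C <= n%:R -> (0 < n)%N -> (k.*2 <= n)%N ->
  (1 - C / n%:R) ^+ (k * (n - k)) <= expR (- (C / 2) * k%:R).
Proof.
move=> /andP[C0 Cn] n0 kn; have nR0 : 0 < n%:R :> R by rewrite ltr0n.
apply: (@le_trans _ _ (expR (- (C / n%:R)) ^+ (k * (n - k)))).
  apply: lerXn2r; rewrite ?nnegrE ?expR_ge0 ?subr_ge0 ?ler_pdivrMr ?mul1r //.
  exact: expR_ge1Dx.
rewrite -expRM_natr ler_expR natrM natrB; last by lia.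
have : 2 * k%:R <= n%:R :> R by rewrite -natrM ler_nat mul2n.
move=> kn'; rewrite !mulNr lerN2.
rewrite (_ : C / n%:R * _ = C * k%:R * ((n%:R - k%:R) / n%:R)); last by field; rewrite gt_eqF.
rewrite (_ : C / 2 * k%:R = C * k%:R * 2^-1); last by field.
by rewrite ler_wpM2l ?mulr_ge0 // ler_pdivlMr //; lra.
Qed.

(** The lower bound on [k] gives [(n / k) ^ k <= expR (C / 8 * k)], so the total exponent is at most
    [(C / 8 + 1 - C / 2) * k]. *)
Lemma closed_weight_le (C : R) (n k : nat) : 24 < C -> (0 < n)%N ->
  n%:R * expR (- (C / 8)) <= k%:R ->
  'C(n, k)%:R * expR (- (C / 2) * k%:R) <= expR (- k%:R).
Proof.
move=> C24 n0 nk.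
have k0 : 0 < k%:R :> R.
  by apply: lt_le_trans nk; rewrite mulr_gt0 ?ltr0n ?expR_gt0.
have nk' : n%:R <= k%:R * expR (C / 8).
  by rewrite -ler_pdivrMr ?expR_gt0 // -expRN.
have : 'C(n, k)%:R * k%:R ^+ k <= k%:R ^+ k * expR (C / 8 * k%:R) * expR k%:R.
  apply: le_trans (bin_expn_le _ _) _; rewrite ler_wpM2r ?expR_ge0 //.
  by rewrite expRM_natr -exprMn lerXn2r // nnegrE ?ler0n // mulr_ge0 ?expR_ge0 ?ler0n.
rewrite mulrC -mulrA ler_pM2l ?exprn_gt0 // => Cb.
apply: le_trans (ler_wpM2r (expR_ge0 _) Cb) _.
rewrite -!expRD ler_expR; nra.
Qed.

Lemma expR_square_le (x : R) : 0 <= x -> (x / 2) ^+ 2 <= expR x.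
Proof.
move=> x0; rewrite {2}(_ : x = x / 2 * 2%:R); last by field.
rewrite expRM_natr lerXn2r ?nnegrE ?expR_ge0 ?divr_ge0 //.
by apply: le_trans (expR_ge1Dx _); rewrite lerDr.
Qed.

(** With [q = k * C / n], one has [n * q = k * C >= 1], so a factor [n] pays for raising the
    exponent [k.-1] to [k]. Then ['C(n, k) * q ^ k] is at most [(C * expR 1) ^ k]. *)
Lemma component_weight_le (C : R) (n k : nat) : 24 < C -> (0 < n)%N -> (0 < k)%N ->
  'C(n, k)%:R * ((k%:R * (C / n%:R)) ^+ k.-1 * expR (- (C / 2) * k%:R)) <=
  n%:R * expR (- k%:R).
Proof.
move=> C24 n0 k0; have nR0 : 0 < n%:R :> R by rewrite ltr0n.
have k1 : 1 <= k%:R :> R by rewrite (ler_nat _ 1 k).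
set q := k%:R * (C / n%:R).
have q0 : 0 < q by rewrite mulr_gt0 ?divr_gt0 //; lra.
have qk : q ^+ k.-1 <= n%:R * q ^+ k.
  rewrite -[in leRHS](prednK k0) exprS mulrA ler_peMl ?exprn_ge0 1?ltW //.
  by rewrite (_ : n%:R * q = k%:R * C) /q; [nra|field; rewrite gt_eqF].
(* It suffices that [C <= (C / 4 - 1) ^ 2], that is [C * (C - 24) + 16 >= 0]. *)
have CC : C <= expR (C / 2 - 2).
  apply: le_trans (expR_square_le _) => //; nra.
have Cq : 'C(n, k)%:R * q ^+ k <= expR ((C / 2 - 2) * k%:R) * expR k%:R.
  rewrite exprMn mulrA.
  apply: (@le_trans _ _ (n%:R ^+ k * expR k%:R * (C / n%:R) ^+ k)).
    by rewrite ler_wpM2r ?bin_expn_le // exprn_ge0 // divr_ge0 //; lra.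
  rewrite mulrAC -exprMn ler_wpM2r ?expR_ge0 // mulrCA divff ?gt_eqF // mulr1.
  by rewrite expRM_natr lerXn2r ?nnegrE ?expR_ge0 //; lra.
rewrite mulrA.
apply: (@le_trans _ _ (n%:R * (expR ((C / 2 - 2) * k%:R) * expR k%:R) * expR (- (C / 2) * k%:R))).
  rewrite ler_wpM2r ?expR_ge0 //.
  apply: le_trans (ler_wpM2l (ler0n _ _) qk) _.
  by rewrite mulrCA ler_wpM2l.
rewrite -mulrA ler_wpM2l // -!expRD ler_expR; lra.
Qed.

Lemma expRN_le_of_4ln (n k : nat) : (0 < n)%N -> 4 * ln n%:R <= k%:R :> R ->
  expR (- k%:R) <= n%:R ^- 4 :> R.
Proof.
move=> n0 nk; rewrite expRN lef_pV2 ?posrE ?exprn_gt0 ?expR_gt0 ?ltr0n //.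
apply: le_trans (_ : expR (4%:R * ln n%:R) <= _); last by rewrite ler_expR.
by rewrite expRM_natl lnK // posrE ltr0n.
Qed.

End Estimates.

(** * Choice of constants and final bound *)

Theorem theorem2 (R : realType) :
  exists C0 : R, 0 < C0 /\
    forall C : R, C0 < C ->
      exists M : R, 0 < M /\
        exists n0 : nat, forall n : nat,
          (n0 <= n)%N -> (1 <= n)%N -> C <= n%:R ->
          1 - expR (- (C / 100)) <= er_prob (C / n%:R) (event_E C M n).
Proof.
(* [C > 24] gives [expR (C / 8) >= 1 + C / 8 > 4], hence [a < 1 / 4]. With [M = 4], sizes
   [k >= M * ln n] have [expR (- k) <= n ^- 4], which beats the polynomial factors. *)
exists 24; split=> // C C24; exists 4; split=> //.
set a := expR (- (C / 8)).
have a0 : 0 < a by apply: expR_gt0.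
have a4 : a < 4^-1.
  rewrite /a expRN ltf_pV2 ?posrE ?expR_gt0 //.
  by apply: lt_le_trans (expR_ge1Dx _); lra.
(* The first summand yields [4 * ln n <= n * a], the second [4 / n <= expR (- (C / 100))]; [n >= 2]
   makes [ln n] positive. *)
pose b := Num.bound (64 / a ^+ 2) + Num.bound (4 * expR (C / 100)).
exists (maxn b 2) => n; rewrite geq_max => /andP[bn n2] n1 Cn.
have nR0 : 0 < n%:R :> R by rewrite ltr0n.
have bnR : b%:R <= n%:R :> R by rewrite ler_nat.
have na : 64 / a ^+ 2 <= n%:R.
  apply: le_trans bnR; apply: le_trans (ltW (archi_boundP _)) _.
    by rewrite divr_ge0 // exprn_ge0 // ltW.
  by rewrite ler_nat leq_addr.
have nC : 4 * expR (C / 100) <= n%:R.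
  apply: le_trans bnR; apply: le_trans (ltW (archi_boundP _)) _.
    by rewrite mulr_ge0 // expR_ge0.
  by rewrite ler_nat leq_addl.
(* Since [n >= 64 / a ^ 2], [n <= (n * a / 8) ^ 2 <= expR (n * a / 4)]. Thus sets counted in [B1]
   also have size at least [4 * ln n]. *)
have lna : 4 * ln n%:R <= n%:R * a.
  have : ln n%:R <= n%:R * a / 4.
    rewrite -ler_expR lnK ?posrE //.
    apply: le_trans (expR_square_le _); last by rewrite divr_ge0 ?mulr_ge0 ?ltW.
    rewrite ler_pdivrMr ?exprn_gt0 // in na.
    rewrite (_ : _ ^+ 2 = n%:R * (n%:R * a ^+ 2 / 64)); last by field.
    by rewrite ler_peMr ?(ltW nR0) // ler_pdivlMr //; lra.
  lra.
have lnn0 : 0 < ln n%:R :> R by rewrite ln_gt0 // (ltr_nat _ 1).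
set p := C / n%:R.
have p0 : 0 <= p by rewrite divr_ge0 //; lra.
have p1 : p <= 1 by rewrite ler_pdivrMr // mul1r.
have C0n : 0 <= C <= n%:R by rewrite Cn andbT; lra.
pose P1 (S : {set 'I_n}) := (n%:R * a <= #|S|%:R) && (#|S|.*2 <= n)%N.
pose P2 (S : {set 'I_n}) := (4 * ln n%:R <= #|S|%:R :> R) && (#|S|.*2 <= n)%N.
pose B1 := [set G : graph n | [exists S, P1 S && [disjoint edge_cut S & G]]].
pose B2 := [set G : graph n | [exists S, P2 S && (S \in components G)]].
have sub : ~: event_E C 4 n \subset B1 :|: B2.
  rewrite subCset; apply/subsetP => G; rewrite !inE negb_or => /andP[nB1 nB2].
  have [||K KG [Ka Kother]] := @giant_component R n G a (4 * ln n%:R) n1 a0 a4.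
  - move=> S clS Sn; rewrite ltNge; apply: contra nB1 => Sa.
    by apply/existsP; exists S; rewrite /P1 Sa Sn.
  - move=> S clS Sn; rewrite ltNge; apply: contra nB2 => Sa.
    by apply/existsP; exists S; rewrite /P2 Sa Sn.
  apply/exists_inP; exists K => //; rewrite Ka /=.
  by apply/forall_inP => K' K'G; apply/implyP => /Kother; apply.
have n4 : 0 <= n%:R ^- 4 :> R by rewrite invr_ge0 exprn_ge0 // ltW.
have B1le : er_prob p B1 <= n.+1%:R * n%:R ^- 4.
  apply: le_trans (er_prob_le_sum p0 p1 (P := P1)
    (B := fun S => [set G : graph n | [disjoint edge_cut S & G]]) _) _.
    by move=> G; rewrite inE => /existsP[S /andP[PS dS]]; exists S; rewrite ?inE.
  apply: sum_set_card_le => // S /andP[Sa Sn].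
  apply: le_trans (expRN_le_of_4ln n1 (le_trans lna Sa)).
  apply: le_trans (closed_weight_le C24 n1 Sa).
  rewrite ler_wpM2l ?ler0n //.
  by apply: le_trans (er_prob_closed p0 p1 _) _; apply: cut_factor_le.
have B2le : er_prob p B2 <= n.+1%:R * (n%:R * n%:R ^- 4).
  apply: le_trans (er_prob_le_sum p0 p1 (P := P2)
    (B := fun S => [set G : graph n | S \in components G]) _) _.
    by move=> G; rewrite inE => /existsP[S /andP[PS dS]]; exists S; rewrite ?inE.
  apply: sum_set_card_le => [|S /andP[Sa Sn]]; first by rewrite mulr_ge0 // ltW.
  (* The empty set is excluded because [ln n > 0]. *)
  have S0 : (0 < #|S|)%N by rewrite -(ltr0n R); lra.
  apply: le_trans (ler_wpM2l (ltW nR0) (expRN_le_of_4ln n1 Sa)).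
  apply: le_trans (component_weight_le C24 n1 S0).
  rewrite ler_wpM2l ?ler0n //.
  apply: le_trans (er_prob_component p0 p1 S0) _.
  rewrite ler_wpM2l ?cut_factor_le // exprn_ge0 // mulr_ge0 ?ler0n //.
rewrite er_probC lerD2l lerN2.
apply: le_trans (er_prob_subset p0 p1 sub) _.
apply: le_trans (er_prob_setU p0 p1 _ _) _.
apply: le_trans (lerD B1le B2le) _.
have n1R : 1 <= n%:R :> R by rewrite (ler_nat _ 1).
(* The two bounds add up to [(n + 1) ^ 2 / n ^ 4], and [(n + 1) ^ 2 <= 4 * n ^ 3]. *)
apply: (@le_trans _ _ (4 / n%:R)).
  rewrite -mulrDr -{1}[n%:R ^- 4]mul1r -mulrDl mulrA ler_pdivrMr ?exprn_gt0 //.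
  rewrite -addn1 natrD (_ : 4 / _ * _ = 4 * n%:R ^+ 3); last by field; rewrite gt_eqF.
  set x := n%:R in n1R *; nra.
by rewrite expRN ler_pdivrMr // mulrC ler_pdivlMr ?expR_gt0.
Qed.
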